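(* For every integer $h\ge 1$ there exists an effectively computable integer $Q_h$ such that $$C_h(Q)<3h\qquad\text{for all integers } Q\ge Q_h .$$ Moreover, one can take $Q_1=2$, $Q_2=19397$, and for $h\ge 3$ one can take as threshold $$Q_h=\exp\left\{\max\left\{\frac{2D(h)}{\Delta_h},\ (h+1)\,W\!\left(\frac{1}{h+1}\left(\frac{h\cdot 2^{3h+9}}{\Delta_h}\right)^{\frac{h+2}{h+1}}\right)\right\}\right\},\qquad \Delta_h=3h-\frac{12(2h-1)}{\pi^2}.$$
   Context: For an integer $Q\ge 2$, let $F_Q=\{a/q: 1\le a\le q\le Q,\ \gcd(a,q)=1\}$ be the $Q$-th Farey sequence, $N=N(Q)=|F_Q|$, and write $F_Q=\{\gamma_1<\gamma_2<\dots<\gamma_N\}$. Set $\gamma_0=0$ and extend periodically to all indices $j>N$ by $\gamma_j=\gamma_{j \bmod N}+\lfloor j/N\rfloor$; in particular $\gamma_{j+N}=\gamma_j+1$. For an integer $h\ge 1$ define $$D_{2,h}(Q)=\sum_{j=1}^{N}(\gamma_{j+h}-\gamma_j)^2,\qquad C_h(Q)=\frac{D_{2,h}(Q)\,Q^2}{\log Q}.$$ $W$ is the Lambert $W$ function, i.e. for $x>0$, $W(x)$ is the positive real number with $W(x)e^{W(x)}=x$. The constant $D(h)$ is $$D(h)=\frac{12}{\pi^2}\left[(2h-1)\left(\gamma-\frac{\zeta'(2)}{\zeta(2)}\right)+\frac h2+(h-1)B+\sum_{k=2}^{h-1}(h-k)I_k\right],$$ where $\gamma$ is Euler's constant, $\zeta$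 is the Riemann zeta function, $$B=\frac12+\log 2+2\sum_{m=1}^{\infty}\frac{\zeta(2m)-1}{2m-1}=2.546277\dots,\qquad I_r=\iint_{\mathscr T}\frac{dx\,dy}{xy\,L_r(x,y)L_{r+1}(x,y)},$$ with $\mathscr T=\{(x,y): 0<x,y\le 1,\ x+y>1\}$ the Farey triangle, and the functions $L_i$ on $\mathscr T$ defined by $L_0(x,y)=x$, $L_1(x,y)=y$ and, for $i\ge 2$, $$L_i(x,y)=\left\lfloor\frac{1+L_{i-2}(x,y)}{L_{i-1}(x,y)}\right\rfloor L_{i-1}(x,y)-L_{i-2}(x,y).$$ *)

(* Defs.v *)
From HB Require Import structures.
From mathcomp Require Import all_boot all_order all_algebra.
From mathcomp Require Import all_classical all_reals all_analysis.
Set Implicit Arguments.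
Unset Strict Implicit.
Unset Printing Implicit Defensive.
Import Order.TTheory GRing.Theory Num.Theory.
Import numFieldNormedType.Exports.
Local Open Scope classical_set_scope.
Local Open Scope ring_scope.

(* The total recursive functions.  Minimisation is only applied when it yields
   a total function, so by Kleene's normal form theorem these are exactly the
   total computable functions. *)
Inductive recursive : forall n : nat, (n.-tuple nat -> nat) -> Prop :=
| recursive_zero n : recursive (fun _ : n.-tuple nat => 0%N)
| recursive_succ : recursive (fun t : 1.-tuple nat => (thead t).+1)
| recursive_proj n (i : 'I_n) : recursive (fun t : n.-tuple nat => tnth t i)
| recursive_comp n m (g : m.-tuple nat -> nat)
    (f : 'I_m -> n.-tuple nat -> nat) :
    recursive g -> (forall i, recursive (f i)) ->
    recursive (fun t => g [tuple f i t | i < m])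
| recursive_prec n (g : n.-tuple nat -> nat) (k : n.+2.-tuple nat -> nat) :
    recursive g -> recursive k ->
    recursive (fun t : n.+1.-tuple nat =>
      nat_rect (fun _ => nat) (g [tuple of behead t])
        (fun i r => k [tuple of i :: r :: [tuple of behead t]]) (thead t))
| recursive_mu n (g : n.+1.-tuple nat -> nat) (f : n.-tuple nat -> nat) :
    recursive g ->
    (forall t, g [tuple of f t :: t] = 0%N) ->
    (forall t y, (y < f t)%N -> g [tuple of y :: t] <> 0%N) ->
    recursive f.

Definition computable (f : nat -> nat) : Prop :=
  recursive (fun t : 1.-tuple nat => f (thead t)).

Definition farey (Q : nat) : seq rat :=
  sort <=%O (undup [seq ((a%:R : rat) / q%:R)
    | q <- iota 1 Q, a <- [seq a <- iota 1 q | coprime a q]]).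

Definition fareyN (Q : nat) : nat := size (farey Q).

(* [farey Q] is indexed from 0 while the sequence gamma_1 < ... < gamma_N is
   indexed from 1; the prepended 0 is gamma_0. *)
Definition fareyg (Q j : nat) : rat :=
  let N := fareyN Q in
  if (j <= N)%N then nth 0 (0 :: farey Q) j
  else nth 0 (0 :: farey Q) (j %% N)%N + (j %/ N)%N%:R.

Definition D2 (h Q : nat) : rat :=
  \sum_(1 <= j < (fareyN Q).+1) (fareyg Q (j + h) - fareyg Q j) ^+ 2.

Section Constants.
Variable R : realType.

Definition C_ (h Q : nat) : R := ratr (D2 h Q) * Q%:R ^+ 2 / ln Q%:R.

(* The Riemann zeta function on the real half-line s > 1, the only place where
   zeta and its derivative are evaluated. *)
Definition zeta (s : R) : R := \big[+%R/0]_(1 <= n <oo) n%:R `^ (- s).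

Definition euler_gamma : R :=
  limn (fun n : nat => \sum_(1 <= k < n.+1) k%:R^-1 - ln n%:R : R).

Definition lambertW (x : R) : R := get [set w : R | 0 < w /\ w * expR w = x].

Definition farey_triangle : set (R * R) :=
  [set p | [/\ 0 < p.1 <= 1, 0 < p.2 <= 1 & 1 < p.1 + p.2]].

Fixpoint L_ (i : nat) (x y : R) : R :=
  match i with
  | 0 => x
  | j.+1 => match j with
            | 0 => y
            | k.+1 => (Num.floor ((1 + L_ k x y) / L_ j x y))%:~R * L_ j x y
                      - L_ k x y
            end
  end.

Definition I_ (r : nat) : R :=
  \int[(lebesgue_measure \x lebesgue_measure)%E]_(p in farey_triangle)
    (p.1 * p.2 * L_ r p.1 p.2 * L_ r.+1 p.1 p.2)^-1.

Definition B_ : R :=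
  2^-1 + ln 2
  + 2 * \big[+%R/0]_(1 <= m <oo) ((zeta (2 * m)%N%:R - 1) / (2 * m%:R - 1)).

Definition D_ (h : nat) : R :=
  12 / pi ^+ 2 *
  ((2 * h%:R - 1) * (euler_gamma - derive1 zeta 2 / zeta 2)
   + h%:R / 2 + (h%:R - 1) * B_
   + \sum_(2 <= k < h) (h%:R - k%:R) * I_ k).

Definition Delta_ (h : nat) : R := 3 * h%:R - 12 * (2 * h%:R - 1) / pi ^+ 2.

Definition threshold (h : nat) : R :=
  expR (Num.max
    (2 * D_ h / Delta_ h)
    ((h%:R + 1) *
     lambertW ((h%:R + 1)^-1 *
       (h%:R * 2 ^+ (3 * h + 9) / Delta_ h) `^ ((h%:R + 2) / (h%:R + 1))))).

End Constants.

(* Main.v *)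
Require Import Defs.
From mathcomp Require Import all_boot all_order all_algebra.
From mathcomp Require Import all_classical all_reals all_analysis.
From mathcomp Require Import zify ring lra.
Set Implicit Arguments.
Unset Strict Implicit.
Unset Printing Implicit Defensive.
Import Order.TTheory GRing.Theory Num.Theory.
Import numFieldNormedType.Exports.
Local Open Scope ring_scope.

(** Write [q_j] for the denominator of the [j]-th Farey fraction.  Consecutive
    fractions have distance [1/(q_j q_(j+1))] and [q_j + q_(j+1) >= Q + 1], so
    the gap is at most [(1/q_j + 1/q_(j+1))/(Q + 1)] ([fareyg_gap_le]).  Hence
    [(Q + 1)^2 D2 h Q] is at most the sum over a period of
    [(1/q_j + 2/q_(j+1) + ... + 2/q_(j+h-1) + 1/q_(j+h))^2].

    Expanding the square, the diagonal contributes [(4 h - 2) A], where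
    [A = \sum_(q <= Q) totient q / q^2] grows like [(6/pi^2) ln Q]: this is the
    true main term of [D2 h Q].  The off-diagonal terms are the correlations
    [S_m = \sum_j 1/(q_j q_(j+m))] with [m >= 1], and do not grow with [Q]: since
    [1/(q_j q_(j+m))] is at most the distance of the two fractions, [S_m <= m]
    ([dencorr_le]).  A small denominator repels the others: inserting successive
    mediants gives [q_(j+m) > Q - m q_j] ([fden_spacing]), which improves the
    bound to [S_m <= ln (m + 4) + 1/2] up to [O(m/Q)] ([dencorr_le_harmonic]).

    For [A] it suffices to use that [totient q] loses the factor [1 - 1/p] for
    [p = 2, 3] when [p] divides [q]: this gives [A <= (2/3) ln Q + 8/10]
    ([totient_sum_le]), and [(2/3) (4 h - 2) < 3 h].  For [h = 1] and [h = 2] the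
    bounds [S_1 <= 1] and [S_2 <= 2] then suffice.  For [h >= 3] the sum of all
    off-diagonal terms is bounded by a cubic polynomial in [h], smaller than
    [(h + 4)/3 * ln Q] once [ln Q >= (h + 1) (3 h/2 + 4)] ([C_lt_of_large_ln]);
    the [lambertW] member of [threshold R h] satisfies this ([threshold_ge]), and
    so does the computable function [2 ^ (2 ^ (h + 4))]. *)

(** * Farey fractions and their periodic enumeration *)

Definition den (x : rat) : nat := `|denq x|%N.

Lemma den_gt0 x : (0 < den x)%N.
Proof. by rewrite absz_gt0 denq_neq0. Qed.

Lemma denE (x : rat) : (den x)%:R = (denq x)%:~R :> rat.
Proof. by rewrite /den natr_absz gtr0_norm // denq_gt0. Qed.

Lemma nonneg_ratE (x : rat) : 0 <= x ->
  exists2 a : nat, x = a%:R / (den x)%:R & coprime a (den x).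
Proof.
move=> x0; exists `|numq x|%N; last exact: coprime_num_den.
rewrite -[LHS]divq_num_den /den.
have -> : numq x = `|numq x|%N :> int by rewrite gez0_abs // numq_ge0.
by rewrite -absz_denq -!pmulrn !absz_nat.
Qed.

Lemma den_dvd (x : rat) (z : int) (q : nat) : x * q%:R = z%:~R ->
  (den x %| q)%N.
Proof.
move=> xq.
have : (denq x %| numq x * q%:Z)%Z.
  apply/dvdzP; exists z; apply: (@intr_inj rat); rewrite !intrM -xq numqE; ring.
rewrite Gauss_dvdzr; first by rewrite dvdzE.
by rewrite coprimezE coprime_sym coprime_num_den.
Qed.

Lemma den_frac_le (a : int) (q : nat) : (0 < q)%N -> (den (a%:~R / q%:R) <= q)%N.
Proof.
move=> q0; apply: dvdn_leq => //; apply: (@den_dvd _ a).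
by rewrite mulfVK // pnatr_eq0 -lt0n.
Qed.

Lemma den_coprime (a q : nat) : (0 < q)%N -> coprime a q ->
  den (a%:R / q%:R) = q.
Proof.
move=> q0 aq; rewrite /den.
have /(@coprimeq_den a q) : coprime `|a%:Z| `|q%:Z| by [].
by rewrite -!pmulrn => ->; case: q q0 {aq}.
Qed.

Lemma den_shift (x : rat) (n : nat) : den (x + n%:R) = den x.
Proof.
have le y m : (den (y + m%:~R) %| den y)%N.
  apply: (@den_dvd _ (numq y + m * denq y)).
  rewrite intrD intrM numqE denE; ring.
apply/eqP; rewrite eqn_dvd; apply/andP; split; first exact: (le x n).
by have := le (x + n%:R) (- n%:Z); rewrite mulrNz addrK.
Qed.

Lemma mem_farey Q x : (x \in farey Q) = (0 < x <= 1) && (den x <= Q)%N.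
Proof.
rewrite mem_sort mem_undup; apply/allpairsPdep/idP => [[q [a [+ + ->]]]|].
  rewrite mem_iota mem_filter mem_iota => q1 /and3P[aq a1 a2].
  have q0 : (0 < q)%N by lia.
  rewrite den_coprime //; have qR : 0 < q%:R :> rat by rewrite ltr0n.
  rewrite ler_pdivrMr // mul1r divr_gt0 ?ltr0n ?ler_nat //=; lia.
move=> /andP[/andP[x0 x1] dx]; have [a xE aq] := nonneg_ratE (ltW x0).
have d0 : 0 < (den x)%:R :> rat by rewrite ltr0n den_gt0.
exists (den x), a; split=> //.
  by rewrite mem_iota den_gt0 add1n ltnS.
rewrite mem_filter aq mem_iota add1n ltnS /=; apply/andP; split.
  by move: x0; rewrite {1}xE pmulr_lgt0 ?invr_gt0 // ltr0n.
by move: x1; rewrite {1}xE ler_pdivrMr // mul1r ler_nat.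
Qed.

Lemma farey_sorted Q : sorted <%O (0 :: farey Q).
Proof.
rewrite /= path_sortedE; last exact: lt_trans.
rewrite sort_lt_sorted undup_uniq andbT.
by apply/allP => x; rewrite mem_farey => /andP[/andP[]].
Qed.

Section FareySequence.
Variable Q : nat.
Hypothesis Q_gt0 : (0 < Q)%N.

Let N := fareyN Q.
Let g i := nth 0 (0 :: farey Q) i.

Lemma farey_nth_ltE i j : (i <= N)%N -> (j <= N)%N -> (g i < g j) = (i < j)%N.
Proof.
by move=> iN jN; rewrite (lt_sorted_ltn_nth _ (farey_sorted Q)) // inE /= ltnS.
Qed.

Lemma farey_nth_le1 i : (i <= N)%N -> g i <= 1.
Proof.
case: i => [|i] iN; first exact: ler01.
by have : g i.+1 \in farey Q by [exact: mem_nth]; rewrite mem_farey => /andP[/andP[]].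
Qed.

Lemma fareyN_gt0 : (0 < fareyN Q)%N.
Proof.
have : 1 \in farey Q by rewrite mem_farey ltr01 lexx /den (denq_int 1) absz1.
by rewrite /fareyN; case: farey.
Qed.

Lemma farey_nth_last : g N = 1.
Proof.
have m1 : 1 \in farey Q by rewrite mem_farey ltr01 lexx /den (denq_int 1) absz1.
pose i := index 1 (farey Q).
have iN : (i.+1 <= N)%N by rewrite /N /fareyN index_mem.
have gi : g i.+1 = 1 by rewrite /g /= nth_index.
apply/le_anti; rewrite farey_nth_le1 //= -[X in X <= _]gi leNgt farey_nth_ltE // -leqNgt //.
Qed.

Lemma fareygE j : fareyg Q j = g (j %% N) + (j %/ N)%:R.
Proof.
rewrite /fareyg -/N -/g; case: ifPn => // jN.
have N0 := fareyN_gt0; rewrite -/N in N0.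
have [jN'|jN'] := ltnP j N; first by rewrite modn_small // divn_small // addr0.
have -> : j = N by lia.
rewrite modnn divnn N0 add0r; exact: farey_nth_last.
Qed.

Lemma fareyg_period j : fareyg Q (j + N) = fareyg Q j + 1.
Proof.
rewrite !fareygE modnDr divnDr ?dvdnn // divnn fareyN_gt0 natrD.
by rewrite addrA.
Qed.

Lemma fareyg_ltS j : fareyg Q j < fareyg Q j.+1.
Proof.
rewrite !fareygE; have N0 := fareyN_gt0; rewrite -/N in N0.
have jm := ltn_pmod j N0; have jE := divn_eq j N.
have [h|h] := ltnP (j %% N).+1 N.
  have -> : (j.+1 %% N)%N = (j %% N).+1.
    by rewrite {1}jE -addnS modnMDl modn_small.
  have -> : (j.+1 %/ N)%N = (j %/ N)%N.
    by rewrite {1}jE -addnS divnMDl // (divn_small h) addn0.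
  by rewrite ltrD2r farey_nth_ltE //; lia.
have jN : j.+1 = ((j %/ N).+1 * N)%N by rewrite mulSn; lia.
have g1 : g (j %% N) < 1 by rewrite -farey_nth_last farey_nth_ltE //; lia.
rewrite jN modnMl mulnK // -natr1 /g /= add0r.
by rewrite [ltRHS]addrC ltrD2r; exact: g1.
Qed.

Lemma fareyg_ltE i j : (fareyg Q i < fareyg Q j) = (i < j)%N.
Proof.
have mono : {homo fareyg Q : i j / (i < j)%N >-> i < j}.
  by apply: homo_ltn fareyg_ltS => ? ? ?; apply: lt_trans.
have [ij|ji|->] := ltngtP i j; first exact: mono.
  by apply/negbTE; rewrite -leNgt ltW // mono.
by rewrite ltxx.
Qed.

Lemma fareyg_leE i j : (fareyg Q i <= fareyg Q j) = (i <= j)%N.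
Proof. by rewrite leNgt fareyg_ltE -leqNgt. Qed.

Lemma fareyg0 : fareyg Q 0 = 0.
Proof. by []. Qed.

Lemma fareyg_ge0 j : 0 <= fareyg Q j.
Proof. by rewrite -fareyg0 fareyg_leE. Qed.

(** Split [x] into integer and fractional parts: the former counts the periods,
    the latter has the same denominator as [x] and is a member of [farey Q] or
    is 0. *)
Lemma fareyg_surj x : 0 <= x -> (den x <= Q)%N -> exists j, fareyg Q j = x.
Proof.
move=> x0 dx; have /andP[n1 n2] := truncn_itv x0.
set n := Num.truncn x in n1 n2 *; rewrite -addn1 natrD in n2.
pose f := x - n%:R; have xE : x = f + n%:R by rewrite subrK.
have df : (den f <= Q)%N by rewrite -(den_shift f n) -xE.
have N0 := fareyN_gt0; rewrite -/N in N0.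
suff [i iN gi] : exists2 i, (i < N)%N & g i = f.
  exists (n * N + i)%N; rewrite fareygE modnMDl divnMDl // modn_small //.
  by rewrite divn_small // addn0 gi -xE.
have [f0|f0] := eqVneq f 0; first by exists 0%N; rewrite ?f0.
have mf : f \in farey Q by rewrite mem_farey df andbT; move: f0; rewrite /f; lra.
have iN : (index f (farey Q) < N)%N by rewrite /N /fareyN index_mem.
have gi : g (index f (farey Q)).+1 = f by rewrite /g /= nth_index.
exists (index f (farey Q)).+1 => //.
rewrite -farey_nth_ltE //; first by rewrite gi farey_nth_last /f; lra.
Qed.

Lemma farey_nth_den i : (den (g i) <= Q)%N.
Proof.
have [iN|iN] := leqP i N; last first.
  by rewrite /g nth_default // /den (denq_int 0) absz1.
case: i iN => [|i] iN; first by rewrite /g /= /den (denq_int 0) absz1.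
by have : g i.+1 \in farey Q by [exact: mem_nth]; rewrite mem_farey => /andP[].
Qed.

Lemma fareyg_den j : (den (fareyg Q j) <= Q)%N.
Proof. by rewrite fareygE den_shift farey_nth_den. Qed.

Definition fden j := den (fareyg Q j).

Lemma fden_gt0 j : (0 < fden j)%N.
Proof. exact: den_gt0. Qed.

Lemma fden_period j : fden (j + N) = fden j.
Proof. by rewrite /fden fareyg_period; exact: (den_shift _ 1). Qed.

Lemma fareyg_gap x j : fareyg Q j < x -> (den x <= Q)%N -> fareyg Q j.+1 <= x.
Proof.
move=> jx dx; have [k xE] := fareyg_surj (le_trans (fareyg_ge0 j) (ltW jx)) dx.
by move: jx; rewrite -xE fareyg_ltE fareyg_leE.
Qed.

Lemma fareyg_gapr x j : 0 <= x -> x < fareyg Q j.+1 -> (den x <= Q)%N ->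
  x <= fareyg Q j.
Proof.
move=> x0 jx dx; have [k xE] := fareyg_surj x0 dx.
by move: jx; rewrite -xE fareyg_ltE fareyg_leE.
Qed.

(** Over the common denominator, the difference has a numerator that is a
    positive integer. *)
Lemma rat_dist_ge (x y : rat) : x < y ->
  (den x)%:R^-1 * (den y)%:R^-1 <= y - x.
Proof.
move=> xy; rewrite -invfM.
have dx : 0 < (den x)%:R :> rat by rewrite ltr0n den_gt0.
have dy : 0 < (den y)%:R :> rat by rewrite ltr0n den_gt0.
rewrite -[_^-1]mul1r ler_pdivrMr ?mulr_gt0 //.
have -> : (y - x) * ((den x)%:R * (den y)%:R) =
  (numq y * denq x - numq x * denq y)%:~R :> rat.
  by rewrite intrB !intrM !numqE !denE; ring.
rewrite -[1]/(1%:~R) ler_int -gtz0_ge1.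
rewrite -(ltr_int rat) intrB !intrM !numqE -!denE subr_gt0.
by rewrite mulrAC [ltRHS]mulrAC -!mulrA [X in _ < _ * X]mulrC ltr_pM2r // mulr_gt0.
Qed.

(** Bezout gives [b/p] with [b q - a p = 1] and [Q - q < p <= Q]; a fraction
    strictly between [a/q] and [b/p] would have denominator at least [p + q],
    so [b/p] is the successor of [a/q]. *)
Lemma farey_neighbors j :
  (Q < fden j + fden j.+1)%N /\
  fareyg Q j.+1 - fareyg Q j = (fden j)%:R^-1 * (fden j.+1)%:R^-1.
Proof.
set x := fareyg Q j; set x' := fareyg Q j.+1.
have qQ := fareyg_den j.
have [a xE aq] := nonneg_ratE (fareyg_ge0 j).
rewrite -/x -/(fden j) in xE aq qQ *.
set q := fden j in xE aq qQ *; have q0 : (0 < q)%N := fden_gt0 j.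
have qR : 0 < q%:R :> rat by rewrite ltr0n.
have /coprimezP[[u v] /= uv] : coprimez a q by [].
pose k := ((Q%:Z + u) %/ q%:Z)%Z; pose r := ((Q%:Z + u) %% q%:Z)%Z.
have kr : Q%:Z + u = k * q%:Z + r := divz_eq _ _.
have r0 : 0 <= r by rewrite modz_ge0 //; lia.
have rq : r < q%:Z by rewrite ltz_pmod.
pose p := `|Q%:Z - r|%N; have pE : p%:Z = Q%:Z - r by rewrite /p; lia.
have pQ : (p <= Q)%N by lia.
have pq : (Q < q + p)%N by lia.
have p0 : (0 < p)%N by lia.
have pR : 0 < p%:R :> rat by rewrite ltr0n.
pose b := a%:Z * k + v.
have bE : b * q%:Z = a%:Z * p%:Z + 1 by rewrite pE /b -uv; nia.
pose y : rat := b%:~R / p%:R.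
have yx : y - x = q%:R^-1 * p%:R^-1.
  have : b%:~R * q%:R = a%:R * p%:R + 1 :> rat.
    by rewrite !pmulrn -[1]/(1%:~R) -!intrM -intrD bE.
  move=> e; rewrite /y xE; apply: (@mulfI _ (q%:R * p%:R)).
    by rewrite mulf_neq0 // lt0r_neq0.
  rewrite mulrBr -invfM divff ?mulf_neq0 ?lt0r_neq0 //.
  transitivity (b%:~R * q%:R - a%:R * p%:R : rat); last by rewrite e; ring.
  by field; rewrite ?lt0r_neq0.
have xy : x < y by rewrite -subr_gt0 yx mulr_gt0 ?invr_gt0.
have dyp : (den y <= p)%N by apply: den_frac_le.
have x'y : x' <= y by apply: fareyg_gap => //; apply: leq_trans pQ.
have q'0 : (0 < fden j.+1)%N := fden_gt0 _.
have q'R : 0 < (fden j.+1)%:R :> rat by rewrite ltr0n.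
have dyR : 0 < (den y)%:R :> rat by rewrite ltr0n den_gt0.
have ley : p%:R^-1 <= (den y)%:R^-1 :> rat by rewrite lef_pV2 // ler_nat.
have y'E : x' = y.
  apply/eqP; rewrite eq_le x'y /= leNgt; apply/negP => x'ly.
  have h1 := rat_dist_ge x'ly; have h2 : x < x' by rewrite fareyg_ltE.
  have {}h2 := rat_dist_ge h2.
  rewrite -/(fden j.+1) in h1; rewrite -/(fden j) -/(fden j.+1) -/q in h2.
  have q'Q := fareyg_den j.+1; rewrite -/(fden j.+1) in q'Q.
  have : (fden j.+1)%:R^-1 * (q%:R^-1 + p%:R^-1) <= q%:R^-1 * p%:R^-1 :> rat.
    have : (fden j.+1)%:R^-1 * p%:R^-1 <= (fden j.+1)%:R^-1 * (den y)%:R^-1 :> rat.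
      by rewrite ler_pM2l ?invr_gt0.
    by move: yx h1 h2; rewrite -/x'; lra.
  have -> : q%:R^-1 + p%:R^-1 = (q%:R^-1 * p%:R^-1) * (q%:R + p%:R) :> rat.
    by field; rewrite !lt0r_neq0.
  rewrite mulrCA -[leRHS]mulr1 ler_pM2l ?mulr_gt0 ?invr_gt0 //.
  rewrite mulrC (ler_pdivrMr _ _ q'R) mul1r -natrD ler_nat => le.
  by have := leq_trans pq le; rewrite ltnNge q'Q.
have dy : den y = p.
  apply/eqP; rewrite eqn_leq dyp /=.
  have := rat_dist_ge xy; rewrite -/(fden j) -/q yx ler_pM2l ?invr_gt0 //.
  by rewrite lef_pV2 // ler_nat.
by rewrite y'E /fden -/x' y'E dy.
Qed.
End FareySequence.

(** * Spacing of small denominators and sums over a period *)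

Lemma mediant_bounds (a b q p : rat) : 0 < q -> 0 < p -> a / q < b / p ->
  a / q < (b + a) / (p + q) < b / p.
Proof.
move=> q0 p0; rewrite ltr_pdivrMr // mulrAC ltr_pdivlMr // => h.
have pq : 0 < p + q by rewrite addr_gt0.
rewrite ltr_pdivrMr // mulrAC ltr_pdivlMr // ltr_pdivrMr // mulrAC ltr_pdivlMr //.
by apply/andP; split; nra.
Qed.

Section FareySpacing.
Variable Q : nat.
Hypothesis Q_gt0 : (0 < Q)%N.
Local Notation fden := (fden Q).

Lemma fareyg_frac j : exists a : nat, fareyg Q j = a%:R / (fden j)%:R.
Proof. by have [a ->] := nonneg_ratE (fareyg_ge0 Q_gt0 j); exists a. Qed.

(** Replacing [b/p] by its mediant with the [j]-th term costs [fden j] in the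
    denominator and produces a new fraction in between, hence gains one index. *)
Lemma fareyg_lt_frac j m (b p : nat) : (0 < p)%N ->
  fareyg Q j < b%:R / p%:R -> (p + m * fden j <= Q)%N ->
  fareyg Q (j + m) < b%:R / p%:R.
Proof.
elim: m b p => [|m IH] b p p0 jy pQ; first by rewrite addn0.
have [a aE] := fareyg_frac j; have q0 := fden_gt0 Q j.
rewrite aE in jy.
have /andP[l1 l2] := mediant_bounds (ltac:(by rewrite ltr0n) : 0 < (fden j)%:R)
  (ltac:(by rewrite ltr0n) : 0 < p%:R) jy.
rewrite -!natrD in l1 l2; apply: le_lt_trans l2.
rewrite addnS; apply: fareyg_gap => //.
  by apply: IH; rewrite ?aE //; nia.
by apply: leq_trans (den_frac_le (b + a)%N _) _; nia.
Qed.

Lemma fareyg_gt_frac j m (b p : nat) : (0 < p)%N -> (m <= j)%N ->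
  b%:R / p%:R < fareyg Q j -> (p + m * fden j <= Q)%N ->
  b%:R / p%:R < fareyg Q (j - m).
Proof.
elim: m b p => [|m IH] b p p0 mj jy pQ; first by rewrite subn0.
have [a aE] := fareyg_frac j; have q0 := fden_gt0 Q j.
rewrite aE in jy.
have /andP[l1 l2] := mediant_bounds (ltac:(by rewrite ltr0n) : 0 < p%:R)
  (ltac:(by rewrite ltr0n) : 0 < (fden j)%:R) jy.
rewrite -!natrD in l1 l2; apply: lt_le_trans l1 _.
apply: (@fareyg_gapr Q Q_gt0); first by rewrite divr_ge0 ?ler0n.
  have -> : (j - m.+1).+1 = (j - m)%N by lia.
  by apply: IH; rewrite ?aE //; nia.
by apply: leq_trans (den_frac_le (a + b)%N _) _; nia.
Qed.

(** The mediants [(b + i a)/(p + i q)], [1 <= i <= m], separate [b/p] from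
    [a/q] by [m] steps as soon as their denominators fit in [Q]. *)
Lemma fden_spacing j m : (0 < m)%N ->
  (Q < fden (j + m) + m * fden j)%N /\ (Q < fden j + m * fden (j + m))%N.
Proof.
move=> m0; split; rewrite ltnNge; apply/negP => le.
  have [b bE] := fareyg_frac (j + m).
  suff : fareyg Q (j + m) < fareyg Q (j + m) by rewrite ltxx.
  rewrite {2}bE; apply: fareyg_lt_frac => //; first exact: fden_gt0.
  by rewrite -bE fareyg_ltE //; lia.
have [b bE] := fareyg_frac j.
suff : fareyg Q j < fareyg Q j by rewrite ltxx.
rewrite {1}bE -[X in _ < fareyg Q X](addnK m).
apply: fareyg_gt_frac => //; first exact: fden_gt0.
- by lia.
- by rewrite -bE fareyg_ltE //; lia.
Qed.

Local Notation N := (fareyN Q).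

Lemma sum_period_shift (V : nmodType) (f : nat -> V) k :
  (forall j, f (j + N)%N = f j) ->
  \sum_(1 <= j < N.+1) f (j + k)%N = \sum_(1 <= j < N.+1) f j.
Proof.
move=> fN; elim: k => [|k IH].
  by apply: eq_bigr => j _; rewrite addn0.
rewrite -IH; have N0 := fareyN_gt0 Q_gt0.
have -> : \sum_(1 <= j < N.+1) f (j + k.+1)%N = \sum_(2 <= j < N.+2) f (j + k)%N.
  by rewrite [RHS]big_add1; apply: eq_bigr => j _; rewrite addnS.
rewrite big_nat_recr //= [RHS]big_ltn // addrC; congr (_ + _).
by rewrite -(fN (1 + k)%N); congr (f _); lia.
Qed.

(** Removing repeated values from a list can only decrease a sum of nonnegative
    terms, which bounds the number of terms of denominator [q] by [totient q]. *)
Lemma sum_fden_le (F : numDomainType) (f : nat -> F) : (forall q, 0 <= f q) ->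
  \sum_(1 <= j < N.+1) f (fden j) <=
  \sum_(1 <= q < Q.+1) (totient q)%:R * f q.
Proof.
move=> f0.
have -> : \sum_(1 <= j < N.+1) f (fden j) = \sum_(x <- farey Q) f (den x).
  rewrite [RHS](big_nth 0) big_add1 /=; apply: eq_big_nat => j jN.
  by rewrite /fden /fareyg ifT.
rewrite (perm_big _ (permEl (perm_sort _ _))) /=.
have und (s : seq rat) : \sum_(x <- undup s) f (den x) <= \sum_(x <- s) f (den x).
  elim: s => [|x s IH] //=; case: ifP => _; rewrite !big_cons ?lerD2l //.
  by rewrite (le_trans IH) // lerDr.
apply: le_trans (und _) _; rewrite big_allpairs_dep /=.
rewrite /index_iota subSS subn0.
rewrite le_eqVlt; apply/orP; left; apply/eqP.
apply: eq_big_seq => q; rewrite mem_iota => q1.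
have q0 : (0 < q)%N by lia.
transitivity (\sum_(a <- iota 1 q | coprime a q) f q).
  rewrite big_filter; apply: eq_bigr => a aq; rewrite den_coprime //.
rewrite big_const_seq iter_addr addr0 mulr_natl; congr (_ *+ _).
rewrite totient_count_coprime -sum1_count big_mkcond /=.
have -> : iota 1 q = index_iota 1 q.+1 by rewrite /index_iota subSS subn0.
rewrite big_nat_recr //= [RHS]big_ltn // addnC /coprime gcdnn gcdn0.
by congr addn => //; apply: eq_bigr => a _; rewrite gcdnC.
Qed.

End FareySpacing.

(** * Window sums and correlations of reciprocal denominators *)

Section Windows.
Variable Q : nat.
Hypothesis Q_gt0 : (0 < Q)%N.
Local Notation N := (fareyN Q).

Definition invden j : rat := (fden Q j)%:R^-1.
(** The gap after the [j]-th term is at most [invden2 j / (Q + 1)], see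
    [fareyg_gap_le]; working with these sums instead of the gaps makes the
    squares and the cross terms separate. *)
Definition invden2 j : rat := invden j + invden j.+1.
Definition dencorr m : rat := \sum_(1 <= j < N.+1) invden j * invden (j + m).
Definition den2corr d : rat := \sum_(1 <= j < N.+1) invden2 j * invden2 (j + d).
Definition window_sum h : rat :=
  \sum_(1 <= j < N.+1) (\sum_(i < h) invden2 (j + i)) ^+ 2.

Lemma invden_gt0 j : 0 < invden j.
Proof. by rewrite invr_gt0 ltr0n fden_gt0. Qed.

Lemma invden_period j : invden (j + N) = invden j.
Proof. by rewrite /invden fden_period. Qed.

Lemma invden2_period j : invden2 (j + N) = invden2 j.
Proof. by rewrite /invden2 -addSn !invden_period. Qed.

Lemma fareyg_diff_period m j :
  fareyg Q (j + N + m) - fareyg Q (j + N) = fareyg Q (j + m) - fareyg Q j.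
Proof. by rewrite addnAC !fareyg_period //; ring. Qed.

Lemma sum_fareyg_diff m :
  \sum_(1 <= j < N.+1) (fareyg Q (j + m) - fareyg Q j) = m%:R.
Proof.
elim: m => [|m IH].
  by rewrite big1 // => j _; rewrite addn0 subrr.
transitivity (\sum_(1 <= j < N.+1) (fareyg Q (j + m) - fareyg Q j) +
  \sum_(1 <= j < N.+1) (fareyg Q (j + m).+1 - fareyg Q (j + m))).
  by rewrite -big_split; apply: eq_bigr => j _ /=; rewrite addnS; ring.
rewrite IH -natr1; congr (_ + _).
rewrite (@sum_period_shift Q Q_gt0 _ (fun j => fareyg Q j.+1 - fareyg Q j) m).
  rewrite telescope_sumr // -[N.+1]add1n fareyg_period //; ring.
by move=> j; have := fareyg_diff_period 1 j; rewrite !addn1.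
Qed.

(** The product of reciprocal denominators is at most the distance of the two
    fractions, and these distances telescope to [m] over a period. *)
Lemma dencorr_le m : (0 < m)%N -> dencorr m <= m%:R.
Proof.
move=> m0; rewrite -sum_fareyg_diff; apply: ler_sum => j _.
by apply: rat_dist_ge; rewrite fareyg_ltE //; lia.
Qed.

(** With [q + q' >= Q + 1], write [1/(q q') = (1/q + 1/q')/(q + q')]. *)
Lemma fareyg_gap_le j : fareyg Q j.+1 - fareyg Q j <= invden2 j / Q.+1%:R.
Proof.
have [qQ ->] := farey_neighbors Q_gt0 j.
rewrite /invden2 /invden; set q := fden Q j in qQ *; set q' := fden Q j.+1 in qQ *.
have q0 : 0 < q%:R :> rat by rewrite ltr0n fden_gt0.
have q'0 : 0 < q'%:R :> rat by rewrite ltr0n fden_gt0.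
have -> : q%:R^-1 + q'%:R^-1 = q%:R^-1 * q'%:R^-1 * (q + q')%:R :> rat.
  by rewrite natrD; field; rewrite !lt0r_neq0.
rewrite ler_pdivlMr ?ltr0n // ler_pM2l ?mulr_gt0 ?invr_gt0 //.
by rewrite ler_nat.
Qed.

Lemma D2_le h : D2 h Q * Q.+1%:R ^+ 2 <= window_sum h.
Proof.
rewrite mulr_suml; apply: ler_sum => j _; rewrite -exprMn lerXn2r ?nnegrE //.
- by rewrite mulr_ge0 // subr_ge0 fareyg_leE //; lia.
- by apply: sumr_ge0 => i _; rewrite addr_ge0 // ltW // invden_gt0.
rewrite -ler_pdivlMr ?ltr0n // mulr_suml.
elim: h => [|h IH]; first by rewrite big_ord0 addn0 subrr.
rewrite big_ord_recr /= addnS -(subrKA (fareyg Q (j + h))).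
by rewrite addrC lerD // fareyg_gap_le.
Qed.

(** By periodicity, a cross term depends only on the lag between its two
    factors. *)
Lemma window_sumS h :
  window_sum h.+1 =
  window_sum h + den2corr 0 + 2 * \sum_(1 <= d < h.+1) den2corr d.
Proof.
transitivity (\sum_(1 <= j < N.+1) ((\sum_(i < h) invden2 (j + i)) ^+ 2
    + invden2 (j + h) ^+ 2 + 2 * \sum_(i < h) invden2 (j + i) * invden2 (j + h))).
  by apply: eq_bigr => j _; rewrite big_ord_recr /= sqrrD -mulr_suml; ring.
rewrite !big_split /=; congr (_ + _ + _).
  rewrite (@sum_period_shift Q Q_gt0 _ (fun j => invden2 j ^+ 2) h).
    by apply: eq_bigr => j _; rewrite addn0 expr2.
  by move=> j; rewrite invden2_period.
rewrite -mulr_sumr; congr (_ * _).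
rewrite exchange_big /= big_add1 /= big_mkord (reindex_inj rev_ord_inj) /=.
apply: eq_bigr => i _.
apply: etrans (@sum_period_shift Q Q_gt0 _
  (fun j => invden2 j * invden2 (j + i.+1)) (h - i.+1) _).
  by apply: eq_bigr => j _; congr (_ * invden2 _); have := ltn_ord i; lia.
by move=> j; rewrite addnAC !invden2_period.
Qed.

Lemma dencorr_shift k m :
  \sum_(1 <= j < N.+1) invden (j + k) * invden (j + k + m) = dencorr m.
Proof.
apply: (@sum_period_shift Q Q_gt0 _ (fun j => invden j * invden (j + m))).
by move=> j; rewrite addnAC !invden_period.
Qed.

Lemma den2corrE d :
  den2corr d.+1 = dencorr d + 2 * dencorr d.+1 + dencorr d.+2.
Proof.
have e := dencorr_shift 1.
transitivity (\sum_(1 <= j < N.+1)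
  (invden j * invden (j + d.+1) + invden j * invden (j + d.+2)
   + invden (j + 1) * invden (j + 1 + d)
   + invden (j + 1) * invden (j + 1 + d.+1))).
  apply: eq_bigr => j _; rewrite /invden2.
  have -> : (j + 1)%N = j.+1 by lia.
  have -> : (j.+1 + d = j + d.+1)%N by lia.
  have -> : (j.+1 + d.+1 = j + d.+2)%N by lia.
  have -> : (j + d.+1).+1 = (j + d.+2)%N by lia.
  ring.
rewrite !big_split /= !e /dencorr; ring.
Qed.

Lemma den2corr0 : den2corr 0 = 2 * dencorr 0 + 2 * dencorr 1.
Proof.
have e := dencorr_shift 1 0.
transitivity (\sum_(1 <= j < N.+1)
  (invden j * invden (j + 0) + invden (j + 1) * invden (j + 1 + 0)
   + 2 * (invden j * invden (j + 1)))).
  by apply: eq_bigr => j _; rewrite /invden2 !addn0 !addn1; ring.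
rewrite !big_split /= !e -mulr_sumr /dencorr; ring.
Qed.

Lemma den2corr0_le : den2corr 0 <= 2 * dencorr 0 + 2.
Proof. by rewrite den2corr0; have := @dencorr_le 1 isT; lra. Qed.

Lemma den2corr1_le : den2corr 1 <= dencorr 0 + 4.
Proof.
by rewrite den2corrE; have := @dencorr_le 1 isT; have := @dencorr_le 2 isT; lra.
Qed.

Lemma window_sum1_le : window_sum 1 <= 2 * dencorr 0 + 2.
Proof.
rewrite window_sumS big_geq // mulr0 addr0 {1}/window_sum big1 ?add0r ?den2corr0_le //.
by move=> j _; rewrite big_ord0 expr0n.
Qed.

Lemma window_sum2_le : window_sum 2 <= 6 * dencorr 0 + 12.
Proof.
rewrite window_sumS big_nat1.
by have := window_sum1_le; have := den2corr0_le; have := den2corr1_le; lra.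
Qed.

(** For lags [d >= 2] the hypothesis gives [den2corr d <= 88/10 + d/2].  The
    last two summands correct this linear law at the lags 1 and 0, where the bounds are
    [A + 4 = 88/10 + 1/2 + (A - 53/10)] and [2 A + 2 = 88/10 + (2 A - 68/10)]:
    among the pairs of positions in a window of length [h], [2 (h - 1)] have lag
    1 and [h] have lag 0. *)
Lemma window_sum_le h (A : rat) : dencorr 0 <= A ->
  (forall m, (0 < m <= h.+1)%N -> dencorr m <= 22 / 10 + m%:R / 8) ->
  window_sum h.+1 <= 88 / 10 * h.+1%:R ^+ 2 + h.+1%:R * (h.+1%:R ^+ 2 - 1) / 6
    + 2 * (h.+1%:R - 1) * (A - 53 / 10) + h.+1%:R * (2 * A - 68 / 10).
Proof.
move=> yA; elim: h => [|h IH] yb.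
  by have := window_sum1_le; lra.
have {}IH := IH (fun m hm => yb m ltac:(lia)).
rewrite window_sumS big_ltn.
  2: lia.
have : \sum_(2 <= d < h.+2) den2corr d <= 88 / 10 * h%:R + h%:R * (h%:R + 3) / 4.
  have : forall k, (k <= h)%N ->
     \sum_(2 <= d < k.+2) den2corr d <= 88 / 10 * k%:R + k%:R * (k%:R + 3) / 4.
    elim=> [|k IHk] hk; first by rewrite big_geq // mulr0 mul0r add0r mul0r.
    have -> : \sum_(2 <= d < k.+3) den2corr d =
        \sum_(2 <= d < k.+2) den2corr d + den2corr k.+2.
      by apply: big_nat_recr; lia.
    rewrite den2corrE.
    have := IHk (ltnW hk).
    have := yb k.+1 ltac:(lia); have := yb k.+2 ltac:(lia).
    have := yb k.+3 ltac:(lia).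
    by rewrite -[k.+3%:R]natr1 -[k.+2%:R]natr1 -[k.+1%:R]natr1; lra.
  by move=> H; apply: (H h (leqnn h)).
have := den2corr0_le; have := den2corr1_le.
by move: IH; rewrite -[h.+2%:R]natr1 -[h.+1%:R]natr1; lra.
Qed.

Lemma dencorr0_le : dencorr 0 <= \sum_(1 <= q < Q.+1) (totient q)%:R / q%:R ^+ 2.
Proof.
rewrite /dencorr.
have := @sum_fden_le Q Q_gt0 rat (fun q => (q%:R ^+ 2)^-1)
  (fun q => ltac:(by rewrite invr_ge0 exprn_ge0)).
apply: le_trans; rewrite le_eqVlt; apply/orP; left; apply/eqP.
by apply: eq_bigr => j _; rewrite addn0 /invden -expr2 exprVn.
Qed.

End Windows.

(** * A logarithmic bound for the correlations *)

Lemma totient_le n : (totient n <= n)%N.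
Proof.
rewrite totient_count_coprime -[leqRHS]muln1 -[X in (_ <= X * _)%N]subn0.
rewrite -sum_nat_const_nat.
by apply: leq_sum => d _; exact: leq_b1.
Qed.

(** If one of the two denominators is at most [Q/s], with [s = m + 4], then the
    spacing lemma makes the other one at least [4 Q/s], so the term is at most
    [s/(4 Q q)]; there are at most [q] fractions of each denominator [q <= Q/s],
    and these terms contribute at most 1/4 for each of the two positions.  If
    both denominators exceed [Q/s], the inequality between the geometric and the
    quadratic mean leaves the harmonic sum over [Q/s < q <= Q]. *)
Lemma dencorr_le_harmonic Q m : (0 < Q)%N -> (0 < m)%N ->
  dencorr Q m <= 2^-1 + \sum_((Q %/ (m + 4)).+1 <= q < Q.+1) q%:R^-1.
Proof.
move=> Q0 m0; set s := (m + 4)%N.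
have QR : 0 < Q%:R :> rat by rewrite ltr0n.
have sR : 0 < s%:R :> rat by rewrite ltr0n; lia.
pose g q : rat := if (s * q <= Q)%N then s%:R / (4 * Q%:R) / q%:R
                  else (2 * q%:R ^+ 2)^-1.
have g0 q : 0 <= g q.
  rewrite /g; case: ifP => _; rewrite ?divr_ge0 ?invr_ge0 ?mulr_ge0 ?exprn_ge0 //.
have small q q' : (0 < q)%N -> (0 < q')%N -> (s * q <= Q)%N ->
    (Q < q' + m * q)%N -> q%:R^-1 * q'%:R^-1 <= g q.
  move=> q0 q'0 sq qq; rewrite /g sq mulrC ler_pM2r ?invr_gt0 ?ltr0n //.
  rewrite -[_^-1]mul1r ler_pdivlMr ?mulr_gt0 // mulrAC ler_pdivrMr ?ltr0n //.
  rewrite mul1r -!natrM ler_nat; nia.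
have large q q' : (0 < q)%N -> (0 < q')%N -> ~~ (s * q <= Q)%N ->
    ~~ (s * q' <= Q)%N -> q%:R^-1 * q'%:R^-1 <= g q + g q'.
  move=> q0 q'0 /negbTE sq /negbTE sq'; rewrite /g sq sq'.
  have e (x : rat) : (2 * x ^+ 2)^-1 = 2^-1 * (x^-1) ^+ 2 by rewrite invfM exprVn.
  rewrite !e.
  by have := sqr_ge0 (q%:R^-1 - q'%:R^-1 : rat); rewrite sqrrB; lra.
have step j : invden Q j * invden Q (j + m) <= g (fden Q j) + g (fden Q (j + m)).
  have [h1 h2] := fden_spacing Q0 j m0; rewrite /invden.
  have q0 := fden_gt0 Q j; have q'0 := fden_gt0 Q (j + m).
  have [c1|c1] := boolP (s * fden Q j <= Q)%N.
    by apply: le_trans (small _ _ q0 q'0 c1 h1) _; rewrite lerDl.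
  have [c2|c2] := boolP (s * fden Q (j + m) <= Q)%N; last exact: large.
  by rewrite mulrC; apply: le_trans (small _ _ q'0 q0 c2 h2) _; rewrite lerDr.
have sumg : \sum_(1 <= j < (fareyN Q).+1) g (fden Q j) <=
    4^-1 + 2^-1 * \sum_((Q %/ s).+1 <= q < Q.+1) q%:R^-1.
  apply: le_trans (sum_fden_le Q0 g0) _.
  have nQ : (Q %/ s <= Q)%N := leq_div Q s.
  rewrite (big_cat_nat (n := (Q %/ s).+1)) //=; apply: lerD.
    apply: (@le_trans _ _ (\sum_(1 <= q < (Q %/ s).+1) s%:R / (4 * Q%:R))).
      rewrite !big_nat; apply: ler_sum => q /andP[q0 qn].
      have sq : (s * q <= Q)%N by rewrite mulnC -leq_divRL //; lia.
      rewrite /g sq mulrCA -[leRHS]mulr1 ler_wpM2l ?divr_ge0 ?mulr_ge0 //.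
      by rewrite ler_pdivrMr ?ltr0n // mul1r ler_nat totient_le.
    rewrite sumr_const_nat subSS subn0 -[_ *+ (Q %/ s)]mulr_natr.
    have : (s * (Q %/ s))%:R <= Q%:R :> rat by rewrite ler_nat mulnC leq_trunc_div.
    rewrite natrM => h; rewrite mulrAC ler_pdivrMr ?mulr_gt0 //; lra.
  rewrite mulr_sumr !big_nat; apply: ler_sum => q /andP[qn qQ].
  have q0 : 0 < q%:R :> rat by rewrite ltr0n; apply: leq_ltn_trans (leq0n _) qn.
  have sq : (s * q <= Q)%N = false.
    by apply/negbTE; rewrite -ltnNge mulnC -ltn_divLR //; lia.
  rewrite /g sq invfM mulrCA ler_pM2l ?invr_gt0 // ler_pdivrMr ?exprn_gt0 //.
  by rewrite expr2 mulKf ?lt0r_neq0 // ler_nat totient_le.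
apply: (@le_trans _ _ (\sum_(1 <= j < (fareyN Q).+1)
   (g (fden Q j) + g (fden Q (j + m))))); first exact: ler_sum.
rewrite big_split /=.
rewrite (@sum_period_shift Q Q0 _ (fun j => g (fden Q j)) m).
  by move: sumg; lra.
by move=> j; rewrite fden_period.
Qed.

(** * Logarithms and totients *)

Section LogBounds.
Variable R : realType.
Implicit Types (t x : R) (n : nat).

(** The difference of the two sides has derivative [1 - (1 - x) exp x], which is
    nonnegative since [1 - x <= exp (- x)]. *)
Lemma expR_pade t : 0 <= t -> (2 - t) * expR t <= 2 + t.
Proof.
move=> t0; pose f x : R := 2 + x - (2 - x) * expR x.
pose df x : R := 1 - (1 - x) * expR x.
have fE x : is_derive x 1 f (df x).
  rewrite /f; apply: is_derive_eq.
  rewrite /GRing.scale /= /df; ring.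
have cf : {within `[0, t], continuous f}%classic.
  have cf x : {for x, continuous f}%classic.
    by apply/differentiable_continuous/derivable1_diffP; have [+ _] := fE x.
  exact: continuous_subspaceT.
have [c c0 e] := MVT_segment t0 (fun x _ => fE x) cf.
have : 0 <= df c.
  rewrite subr_ge0 -[leRHS](expRxMexpNx_1 c) mulrC ler_pM2l ?expR_gt0 //.
  by have := expR_ge1Dx (- c); lra.
move: e; rewrite subr0 {1 2}/f expR0 => e dc.
have : 0 <= df c * t by rewrite mulr_ge0.
by rewrite -e; lra.
Qed.

(** This is [expR_pade] at [t = 2/(2 n + 1)], where [(2 + t)/(2 - t)] equals
    [(n + 1)/n]. *)
Lemma ln_step_ge n : (0 < n)%N ->
  2 / (2 * n%:R + 1) <= ln n.+1%:R - ln n%:R :> R.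
Proof.
move=> n0; have nR : 0 < n%:R :> R by rewrite ltr0n.
rewrite -ln_div ?posrE ?ltr0n // -ler_expR lnK ?posrE ?divr_gt0 ?ltr0n //.
set t := 2 / _.
have d0 : 0 < 2 * n%:R + 1 :> R by lra.
have t0 : 0 <= t by rewrite divr_ge0 // ltW.
have := expR_pade t0.
have -> : 2 + t = (2 - t) * (n.+1%:R / n%:R).
  by rewrite /t -natr1; field; rewrite !lt0r_neq0.
rewrite ler_pM2l // /t subr_gt0 ltr_pdivrMr //; lra.
Qed.

Lemma ln_step_inv n : (0 < n)%N ->
  n.+1%:R^-1 <= ln n.+1%:R - ln n%:R :> R.
Proof.
move=> n0; apply: le_trans (ln_step_ge n0).
have nR : 0 < n%:R :> R by rewrite ltr0n.
rewrite -[_^-1]mul1r ler_pdivrMr ?ltr0n // mulrAC ler_pdivlMr -?natr1; lra.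
Qed.

Lemma ln2_ge : 24 / 35 <= ln 2 :> R.
Proof.
have h2 : 2 / 5 <= ln 3 - ln 2 :> R.
  by apply: le_trans (@ln_step_ge 2 isT); rewrite ler_pdivlMr; lra.
have h3 : 2 / 7 <= ln 4 - ln 3 :> R.
  by apply: le_trans (@ln_step_ge 3 isT); rewrite ler_pdivlMr; lra.
have h4 : ln 4 = 2 * ln 2 :> R.
  by rewrite -[4%:R]/((2 * 2)%:R) natrM lnM ?posrE //; ring.
lra.
Qed.

Lemma ln3_ge : 38 / 35 <= ln 3 :> R.
Proof.
have h2 : 2 / 5 <= ln 3 - ln 2 :> R.
  by apply: le_trans (@ln_step_ge 2 isT); rewrite ler_pdivlMr; lra.
by have := ln2_ge; lra.
Qed.

Lemma ln2_le : ln 2 <= 71 / 100 :> R.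
Proof.
rewrite -ler_expR lnK ?posrE //.
have -> : 71 / 100 = 16%:R * (71 / 1600) :> R by lra.
rewrite expRM_natl.
apply: (@le_trans _ _ ((1 + 71 / 1600) ^+ 16)); first by lra.
apply: lerXn2r; last exact: expR_ge1Dx.
  by rewrite nnegrE; lra.
by rewrite nnegrE expR_ge0.
Qed.

Lemma harmonic_le_ln m n : (0 < m <= n)%N ->
  \sum_(m.+1 <= q < n.+1) q%:R^-1 <= ln n%:R - ln m%:R :> R.
Proof.
move=> /andP[m0]; elim: n => [|n IH]; first by lia.
rewrite leq_eqVlt => /orP[/eqP <-|mn]; first by rewrite big_geq // subrr.
have -> : \sum_(m.+1 <= q < n.+2) q%:R^-1 =
   \sum_(m.+1 <= q < n.+1) q%:R^-1 + n.+1%:R^-1 :> R by apply: big_nat_recr; lia.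
have n0 : (0 < n)%N by lia.
by apply: le_trans (lerD (IH mn) (ln_step_inv n0)) _; lra.
Qed.

End LogBounds.

Lemma totient_dvd_prime p n : prime p -> (0 < n)%N -> (p %| n)%N ->
  exists k m, [/\ n = (p ^ k.+1 * m)%N, coprime p m &
    totient n = (p.-1 * p ^ k * totient m)%N].
Proof.
move=> pp n0 pn; have [k k0] : exists k, logn p n = k.+1.
  have := logn_gt0 p n; rewrite mem_primes pp n0 pn.
  by case: logn => // k; exists k.
have [m co nE] := pfactor_coprime pp n0.
exists k, m; rewrite -k0 [in RHS]mulnC; split => //.
rewrite nE k0 totient_coprime ?totient_pfactor //=; first by rewrite mulnC.
by rewrite coprime_sym coprimeXl.
Qed.

Lemma totient_even n : (0 < n)%N -> (2 %| n)%N -> (2 * totient n <= n)%N.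
Proof.
move=> n0 h; have [k [m [-> _ ->]]] := @totient_dvd_prime 2 n isT n0 h.
by rewrite mul1n mulnA expnS leq_mul2l totient_le orbT.
Qed.

Lemma totient_mul3 n : (0 < n)%N -> (3 %| n)%N -> (3 * totient n <= 2 * n)%N.
Proof.
move=> n0 h; have [k [m [-> _ ->]]] := @totient_dvd_prime 3 n isT n0 h.
by have := totient_le m; rewrite expnS; nia.
Qed.

Lemma totient_mul6 n : (0 < n)%N -> (6 %| n)%N -> (3 * totient n <= n)%N.
Proof.
move=> n0; rewrite (@Gauss_dvd 2 3) // => /andP[h2 h3].
have [k [m [nE co tE]]] := @totient_dvd_prime 2 n isT n0 h2.
have m0 : (0 < m)%N by lia.
have m3 : (3 %| m)%N by rewrite nE Gauss_dvdr ?coprimeXr // in h3.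
by have := totient_mul3 m0 m3; rewrite tE nE expnS; nia.
Qed.

(** * The sum of totient q / q^2 *)

Definition totient_sum (F : numFieldType) (Q : nat) : F :=
  \sum_(1 <= q < Q.+1) (totient q)%:R / q%:R ^+ 2.

Section TotientSum.
Variable R : realType.

(** A periodic primitive: [2/3 + osc (n + 1) - osc n] is the value that the
    divisibility of [n + 1] by 2 and 3 allows for [totient (n + 1)/(n + 1)].  The
    additive constant makes it at most 1/6; the step from [n] to [n + 1] in
    [totient_sum_le_osc] holds as long as [osc n <= 2 n/(3 (2 n + 1))]. *)
Definition osc (n : nat) : R :=
  nth 0 [:: - 6^-1; 6^-1; 0; 0; - 6^-1; 6^-1] (n %% 6).

Lemma osc_le n : osc n <= 6^-1.
Proof.
rewrite /osc; have : (n %% 6 < 6)%N by rewrite ltn_mod.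
case: (n %% 6)%N => [|[|[|[|[|[|//]]]]]] _ /=; lra.
Qed.

Lemma totient_le_osc n :
  (totient n.+1)%:R <= (2 / 3 + osc n.+1 - osc n) * n.+1%:R.
Proof.
have key (a b : nat) : (b * totient n.+1 <= a * n.+1)%N -> (0 < b)%N ->
    (totient n.+1)%:R <= a%:R / b%:R * n.+1%:R :> R.
  by move=> h b0; rewrite mulrAC ler_pdivlMr ?ltr0n // -!natrM ler_nat mulnC.
rewrite /osc; have m : (n.+1 %% 6 = (n %% 6).+1 %% 6)%N by lia.
have : (n %% 6 < 6)%N by rewrite ltn_mod.
have nE : (n = n %/ 6 * 6 + n %% 6)%N := divn_eq n 6.
rewrite m; case: (n %% 6)%N nE => [|[|[|[|[|[|//]]]]]] nE _ /=.
- have := key 1%N 1%N (ltac:(by rewrite !mul1n totient_le)) isT.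
  by move/le_trans; apply; rewrite ler_pM2r ?ltr0n //; lra.
- have := key 1%N 2%N (ltac:(by rewrite mul1n totient_even //; lia)) isT.
  by move/le_trans; apply; rewrite ler_pM2r ?ltr0n //; lra.
- have := key 2%N 3%N (ltac:(by rewrite totient_mul3 //; lia)) isT.
  by move/le_trans; apply; rewrite ler_pM2r ?ltr0n //; lra.
- have := key 1%N 2%N (ltac:(by rewrite mul1n totient_even //; lia)) isT.
  by move/le_trans; apply; rewrite ler_pM2r ?ltr0n //; lra.
- have := key 1%N 1%N (ltac:(by rewrite !mul1n totient_le)) isT.
  by move/le_trans; apply; rewrite ler_pM2r ?ltr0n //; lra.
- have := key 1%N 3%N (ltac:(by rewrite mul1n totient_mul6 //; lia)) isT.
  by move/le_trans; apply; rewrite ler_pM2r ?ltr0n //; lra.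
Qed.

Lemma totient_sumS n :
  totient_sum R n.+1 = totient_sum R n + (totient n.+1)%:R / n.+1%:R ^+ 2.
Proof. by apply: big_nat_recr. Qed.

Lemma totient_sum1 : totient_sum R 1 = 1.
Proof. by rewrite /totient_sum big_nat1 totient_count_coprime big_nat1 expr1n divr1. Qed.

Lemma totient_sum_small :
  [/\ totient_sum R 2 <= 125 / 100, totient_sum R 3 <= 1473 / 1000,
      totient_sum R 4 <= 1598 / 1000, totient_sum R 5 <= 1758 / 1000 &
      totient_sum R 6 <= 1814 / 1000].
Proof.
have t n (a : nat) : (totient n.+1 <= a)%N ->
    totient_sum R n.+1 <= totient_sum R n + a%:R / n.+1%:R ^+ 2.
  move=> h; rewrite totient_sumS lerD2l ler_pM2r; first by rewrite ler_nat.
  by rewrite invr_gt0 exprn_gt0 // ltr0n.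
have t2 := t 1%N 1%N (ltac:(by have := @totient_even 2 isT isT; lia)).
have t3 := t 2%N 2%N (ltac:(by have := @totient_mul3 3 isT isT; lia)).
have t4 := t 3%N 2%N (ltac:(by have := @totient_even 4 isT isT; lia)).
have t5 := t 4%N 4%N (ltac:(by rewrite totient_prime)).
have t6 := t 5%N 2%N (ltac:(by have := @totient_mul6 6 isT isT; lia)).
rewrite totient_sum1 in t2; split; lra.
Qed.

(** The density [2/3 = (1 - 1/4) (1 - 1/9)] takes only the primes 2 and 3 into
    account.  With the periodic correction the step no longer depends on the
    residue of [n], and follows from [ln (1 + 1/n) >= 2/(2 n + 1)]. *)
Lemma totient_sum_le_osc n : (6 <= n)%N ->
  totient_sum R n <= 2 / 3 * ln n%:R + 3 / 4 + osc n / n%:R.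
Proof.
elim: n => // n IH; rewrite leq_eqVlt => /orP[/eqP <-|].
  have [_ _ _ _ t6] := totient_sum_small.
  have l6 : ln 6%:R = ln 2 + ln 3 :> R by rewrite -[6%:R]/((2 * 3)%:R) natrM lnM ?posrE.
  rewrite /osc l6 /=; have := ln2_ge R; have := ln3_ge R; lra.
rewrite ltnS => n6; have {}IH := IH n6.
have n0 : (0 < n)%N by lia.
have nR : 0 < n%:R :> R by rewrite ltr0n.
have mR : 0 < n.+1%:R :> R by rewrite ltr0n.
rewrite totient_sumS.
have t1 : (totient n.+1)%:R / n.+1%:R ^+ 2 <=
    (2 / 3 + osc n.+1 - osc n) / n.+1%:R :> R.
  rewrite ler_pdivrMr ?exprn_gt0 // expr2 mulrA mulfVK ?lt0r_neq0 //.
  exact: totient_le_osc.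
have o := osc_le n.
have l := @ln_step_ge R n n0.
suff : osc n / n%:R - osc n / n.+1%:R + 2 / 3 / n.+1%:R <=
    2 / 3 * (2 / (2 * n%:R + 1)).
  move: IH t1 l; set u := n%:R^-1; set v := n.+1%:R^-1.
  set t := _ / n.+1%:R ^+ 2; set w := 2 / (_ + 1).
  move: t w (totient_sum R n) (ln n%:R) (ln n.+1%:R) (osc n) (osc n.+1) => t w T l l' e e'.
  by lra.
have -> : osc n / n%:R - osc n / n.+1%:R = osc n / (n%:R * n.+1%:R).
  by rewrite -natr1; field; rewrite natr1 !lt0r_neq0.
apply: (@le_trans _ _ (6^-1 / (n%:R * n.+1%:R) + 2 / 3 / n.+1%:R)).
  by rewrite lerD2r ler_pM2r // invr_gt0 mulr_gt0.
rewrite -subr_ge0.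
have -> : 2 / 3 * (2 / (2 * n%:R + 1)) - (6^-1 / (n%:R * n.+1%:R) + 2 / 3 / n.+1%:R)
  = (2 * n%:R - 1) / (6 * n%:R * n.+1%:R * (2 * n%:R + 1)) :> R.
  have ne1 : n%:R + 1 != 0 :> R by rewrite natr1 lt0r_neq0.
  have ne2 : 2 * n%:R + 1 != 0 :> R by apply: lt0r_neq0; lra.
  by rewrite -natr1; field; rewrite ne2 addrC ne1 lt0r_neq0.
have n1 : 1 <= n%:R :> R by rewrite ler1n.
by rewrite divr_ge0 ?mulr_ge0 //; lra.
Qed.

Lemma totient_sum_le n : (2 <= n)%N -> totient_sum R n <= 2 / 3 * ln n%:R + 8 / 10.
Proof.
move=> n2; have [n6|] := leqP 6 n.
  apply: le_trans (totient_sum_le_osc n6) _.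
  have : osc n / n%:R <= 1 / 20; last by lra.
  have n6' : 6 <= n%:R :> R by rewrite ler_nat.
  by rewrite ler_pdivrMr; have := osc_le n; lra.
have [t2 t3 t4 t5 _] := totient_sum_small.
have l2 := ln2_ge R; have l3 := ln3_ge R.
have l4 : ln 4%:R = 2 * ln 2 :> R.
  by rewrite -[4%:R]/((2 * 2)%:R) natrM lnM ?posrE //; ring.
have l5 := @ln_step_inv R 4 isT.
case: n n2 => [|[|[|[|[|[|//]]]]]] // _ _; lra.
Qed.

End TotientSum.

(** * Upper bounds for C_h *)

Section RealBounds.
Variable R : realType.

Lemma ratr_totient_sum Q : ratr (totient_sum rat Q) = totient_sum R Q.
Proof.
rewrite rmorph_sum /=; apply: eq_bigr => q _.
by rewrite fmorph_div rmorphXn /= !ratr_nat.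
Qed.

Lemma ratr_dencorr0_le Q : (2 <= Q)%N ->
  ratr (dencorr Q 0) <= 2 / 3 * ln Q%:R + 8 / 10 :> R.
Proof.
move=> Q2; apply: le_trans (totient_sum_le R Q2).
by rewrite -ratr_totient_sum ler_rat dencorr0_le //; lia.
Qed.

(** The harmonic sum is at most [ln (m + 4)] up to a term of order [m/Q], and the
    tangent of the logarithm at 8 gives [ln (m + 4) <= 3 ln 2 + m/8 - 1/2]. *)
Lemma ratr_dencorr_le Q m : (0 < m)%N -> (15 * (m + 4) <= Q)%N ->
  ratr (dencorr Q m) <= 22 / 10 + m%:R / 8 :> R.
Proof.
move=> m0 mQ; have Q0 : (0 < Q)%N by lia.
have := dencorr_le_harmonic Q0 m0; rewrite -(ler_rat R).
rewrite rmorphD fmorphV rmorph_nat => h; apply: le_trans h _.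
have V (q : nat) : ratr q%:R^-1 = q%:R^-1 :> R by rewrite fmorphV rmorph_nat.
rewrite rmorph_sum /=; under eq_bigr do rewrite V.
set s := (m + 4)%N in mQ *; set n := (Q %/ s)%N.
have s0 : (0 < s)%N by rewrite /s; lia.
have nQ : (n < Q)%N by apply: ltn_Pdiv; rewrite /s //; lia.
rewrite big_ltn //.
have h1 := @harmonic_le_ln R n.+1 Q nQ.
have QR : 0 < Q%:R :> R by rewrite ltr0n.
have sR : 0 < s%:R :> R by rewrite ltr0n.
have nR : 0 < n.+1%:R :> R by rewrite ltr0n.
have ns : Q%:R <= s%:R * n.+1%:R :> R.
  by rewrite -natrM ler_nat mulnC ltnW // ltn_ceil.
have h2 : ln Q%:R <= ln s%:R + ln n.+1%:R :> R.
  by rewrite -lnM ?posrE // ler_ln ?posrE ?mulr_gt0.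
have h3 : n.+1%:R^-1 <= 15^-1 :> R.
  rewrite lef_pV2 ?posrE ?ltr0n // ler_nat.
  by apply: leqW; rewrite /n leq_divRL.
have h4 : ln s%:R <= 3 * ln 2 + m%:R / 8 - 2^-1 :> R.
  have e : s%:R = 8 * (1 + (m%:R / 8 - 2^-1)) :> R by rewrite /s natrD; lra.
  have p : 0 < 1 + (m%:R / 8 - 2^-1) :> R.
    by have : 0 <= m%:R :> R by []; lra.
  have l8 : ln 8%:R = 3 * ln 2 :> R.
    by rewrite -[8%:R]/((2 ^ 3)%:R) natrX lnXn // mulr_natl.
  rewrite e lnM ?posrE // l8 -addrA lerD2l; apply: le_ln1Dx; lra.
have h5 := ln2_le R.
move: h1 h2 h3 h4 h5; set A := \sum_(_ <= _ < _) _; set B := n.+1%:R^-1.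
by move: (ln Q%:R) (ln n.+1%:R) => X Y; lra.
Qed.

Lemma C_lt_of_D2_lt h Q (b : R) : (2 <= Q)%N ->
  ratr (D2 h Q) * Q%:R ^+ 2 < b * ln Q%:R -> C_ R h Q < b.
Proof.
by move=> Q2 lt; rewrite /C_ ltr_pdivrMr // ln_gt0 // ltr1n.
Qed.

Lemma ratr_D2_le h Q : (0 < Q)%N ->
  ratr (D2 h Q) * Q.+1%:R ^+ 2 <= ratr (window_sum Q h) :> R.
Proof.
move=> Q0; have := D2_le Q0 h; rewrite -(ler_rat R).
by rewrite rmorphM rmorphXn /= ratr_nat.
Qed.

Lemma D2_ge0 h Q : 0 <= ratr (D2 h Q) :> R.
Proof. by rewrite ler0q; apply: sumr_ge0 => j _; rewrite sqr_ge0. Qed.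

Lemma ratr_D2_sq_le h Q : (0 < Q)%N ->
  ratr (D2 h Q) * Q%:R ^+ 2 <= ratr (window_sum Q h) :> R.
Proof.
move=> Q0; apply: le_trans (ratr_D2_le h Q0).
rewrite ler_wpM2l ?D2_ge0 // lerXn2r ?nnegrE ?ler0n // ler_nat //.
Qed.

Lemma ratr_window_bound (x A : rat) :
  ratr (88 / 10 * x ^+ 2 + x * (x ^+ 2 - 1) / 6
    + 2 * (x - 1) * (A - 53 / 10) + x * (2 * A - 68 / 10)) <=
  88 / 10 * ratr x ^+ 2 + ratr x * (ratr x ^+ 2 - 1) / 6
    + 2 * (ratr x - 1) * (ratr A - 53 / 10)
    + ratr x * (2 * ratr A - 68 / 10) :> R.
Proof. by rewrite le_eqVlt; apply/orP; left; apply/eqP; field. Qed.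

(** The bound of [window_sum_le] has leading term [(2/3) (4 h - 2) ln Q], which
    falls short of [3 h ln Q] by [(h + 4)/3 * ln Q].  The lower bound assumed on [ln Q]
    makes this exceed the remaining cubic polynomial in [h]. *)
Lemma C_lt_of_large_ln h Q : (3 <= h)%N -> (2 <= Q)%N ->
  (h%:R + 1) * (3 / 2 * h%:R + 4) <= ln Q%:R :> R -> C_ R h Q < 3 * h%:R.
Proof.
move=> h3 Q2 lQ; apply: C_lt_of_D2_lt => //.
have Q0 : (0 < Q)%N by lia.
apply: le_lt_trans (ratr_D2_sq_le h Q0) _.
have hR : 3 <= h%:R :> R by rewrite ler_nat.
have Qh : (15 * (h + 4) <= Q)%N.
  rewrite -(ler_nat R) natrM natrD -[leRHS]lnK ?posrE ?ltr0n //.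
  apply: le_trans (expR_ge1Dxn 1 _); last by nra.
  move: lQ hR; set l := ln _; set x := h%:R => lQ hR.
  rewrite -[2`!]/2%N.
  have : 34 <= l by nra.
  by nra.
case: h h3 lQ hR Qh => // h h3 lQ hR Qh.
have := @window_sum_le Q Q0 h (dencorr Q 0) (lexx _).
rewrite -(ler_rat R); move=> zb.
have {}zb := zb (fun m hm => ltac:(
  rewrite -(ler_rat R); have := @ratr_dencorr_le Q m ltac:(lia) ltac:(lia);
  by rewrite rmorphD /= !fmorph_div /= !ratr_nat)).
have {zb} := le_trans zb (ratr_window_bound _ _).
have := ratr_dencorr0_le Q2; rewrite ratr_nat.
move: lQ hR; move: (ln _) (ratr (dencorr Q 0)) (ratr (window_sum Q _)) => l A Z.
move: (h.+1%:R) => x lx x3 Al zZ; apply: le_lt_trans zZ _.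
have h1 : 0 <= (x + 4) * (l - (x + 1) * (3 / 2 * x + 4)) by nra.
have h2 : 0 <= (4 * x - 2) * (2 / 3 * l + 8 / 10 - A) by nra.
(* a quadratic of negative discriminant, with minimum near 7.45 *)
have h3' : 0 < x * (x ^+ 2 / 3 - 4967 / 1000 * x + 217 / 10).
  have := sqr_ge0 (x - 7451 / 1000); rewrite sqrrB => sq; clear -x3 sq; apply: mulr_gt0; lra.
nra.
Qed.

(** Here [D2 1 Q <= (2 A + 2)/(Q + 1)^2] with [A <= (2/3) ln Q + 8/10]. *)
Lemma C1_lt Q : (2 <= Q)%N -> C_ R 1 Q < 3 * 1%:R.
Proof.
move=> Q2; apply: C_lt_of_D2_lt => //; have Q0 : (0 < Q)%N by lia.
have lZ := le_trans (ratr_D2_le 1 Q0) _.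
have := window_sum1_le Q0; rewrite -(ler_rat R) rmorphD rmorphM /= !ratr_nat => zb.
have A := ratr_dencorr0_le Q2; have := lZ _ zb => {lZ zb}.
have d0 := D2_ge0 1 Q; move: d0 A; set d := ratr _; set l := ln _ => d0 A dA.
have QR : 2 <= Q%:R :> R by rewrite ler_nat.
(* for small [Q], where [ln Q] is barely large enough, the quotient
   [Q^2/(Q+1)^2] must be kept *)
suff lb : (4 / 3 * l + 36 / 10) * Q%:R ^+ 2 < 3 * l * Q.+1%:R ^+ 2.
  have p : 0 < Q.+1%:R ^+ 2 :> R by rewrite exprn_gt0 // ltr0n.
  rewrite -(ltr_pM2r p) mulr1; apply: le_lt_trans lb.
  rewrite mulrAC ler_pM2r ?exprn_gt0 //; last by lra.
  by apply: le_trans dA _; lra.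
have l2 := ln2_ge R; have l3 := ln3_ge R.
have l4 : ln 4%:R = 2 * ln 2 :> R.
  by rewrite -[4%:R]/((2 * 2)%:R) natrM lnM ?posrE //; ring.
have l6 : ln 6%:R = ln 2 + ln 3 :> R.
  by rewrite -[6%:R]/((2 * 3)%:R) natrM lnM ?posrE.
have l9 : ln 9%:R = 2 * ln 3 :> R.
  by rewrite -[9%:R]/((3 * 3)%:R) natrM lnM ?posrE //; ring.
have mono (k : nat) : (0 < k)%N -> (k <= Q)%N -> ln k%:R <= l.
  by move=> k0 kQ; rewrite ler_ln ?posrE ?ltr0n // ler_nat.
rewrite -[Q.+1%:R]natr1.
have [Q9|Q9] := leqP 9 Q.
  have := mono 9%N isT Q9; rewrite l9 => lb.
  have QR9 : 9 <= Q%:R :> R by rewrite ler_nat.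
  move: Q%:R QR9 => x x9.
  have h1 : 0 < (5 / 3 * l - 36 / 10) * x ^+ 2 by apply: mulr_gt0; nra.
  have h2 : 0 < l * (2 * x + 1) by apply: mulr_gt0; lra.
  by lra.
have [Q6|Q6] := leqP 6 Q.
  have := mono 6%N isT Q6; rewrite l6 => lb.
  have Q1 : 6 <= Q%:R :> R by rewrite ler_nat.
  have Q2' : Q%:R <= 8 :> R by rewrite ler_nat; lia.
  move: Q%:R {mono} Q1 Q2' => x x6 x8.
  have h1 : 0 <= (l - 177 / 100) * (3 * (x + 1) ^+ 2 - 4 / 3 * x ^+ 2).
    by apply: mulr_ge0; [lra | nra].
  have h2 : 0 <= (8 - x) * x by apply: mulr_ge0; lra.
  by nra.
have [Q4|Q4] := leqP 4 Q.
  have := mono 4%N isT Q4; rewrite l4 => lb.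
  have : Q = 4%N \/ Q = 5%N by lia.
  by case=> ->; lra.
have : Q = 2%N \/ Q = 3%N by lia.
rewrite /l; case=> ->; lra.
Qed.

Lemma C2_lt Q : (19397 <= Q)%N -> C_ R 2 Q < 3 * 2%:R.
Proof.
move=> Qb; have Q2 : (2 <= Q)%N := leq_trans (isT : (2 <= 19397)%N) Qb.
apply: C_lt_of_D2_lt => //; have Q0 : (0 < Q)%N by lia.
apply: le_lt_trans (ratr_D2_sq_le 2 Q0) _.
have := window_sum2_le Q0; rewrite -(ler_rat R) rmorphD rmorphM /= !ratr_nat => zb.
apply: le_lt_trans zb _.
(* [19397 >= 2^14], and [6 A + 12 < 6 ln Q] as soon as [ln Q > 42/5] *)
have l14 : 14 * ln 2 <= ln Q%:R :> R.
  rewrite mulr_natl -lnXn // ler_ln ?posrE ?exprn_gt0 ?ltr0n // -natrX ler_nat.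
  exact: leq_trans (isT : (2 ^ 14 <= 19397)%N) Qb.
have := ratr_dencorr0_le Q2; have := ln2_ge R; lra.
Qed.

End RealBounds.

(** * The explicit threshold *)

Section Threshold.
Variable R : realType.

Lemma sin_le_id (x : R) : 0 <= x -> sin x <= x.
Proof.
move=> x0.
have cs : {within `[0, x], continuous (@sin R)}%classic.
  by apply: continuous_subspaceT; exact: continuous_sin.
have [c _] := MVT_segment x0 (fun x _ => is_derive_sin x) cs.
by rewrite sin0 !subr0 => ->; rewrite -[leRHS]mul1r ler_wpM2r // cos_le1.
Qed.

(** [sin (pi/4)^2 = 1/2], and the sine is at most its argument. *)
Lemma pi_sq_ge : 8 <= pi ^+ 2 :> R.
Proof.
have p0 := pi_gt0 R; pose t : R := pi / 4.
have t2 : t + t = pi / 2 by rewrite /t; lra.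
have c2 : cos t ^+ 2 = sin t ^+ 2.
  by have := cosD t t; rewrite t2 cos_pihalf -!expr2 => /esym/eqP; rewrite subr_eq0 => /eqP.
have s2 : sin t ^+ 2 = 2^-1 by have := cos2Dsin2 t; rewrite c2; lra.
have s0 : 0 <= sin t by apply: sin_ge0_pi; rewrite /t; apply/andP; split; lra.
have : sin t ^+ 2 <= t ^+ 2.
  by rewrite lerXn2r ?nnegrE // ?sin_le_id // /t; lra.
by rewrite s2 /t expr_div_n; lra.
Qed.

Lemma Delta_bounds h : (1 <= h)%N ->
  0 < Delta_ R h <= 3 / 2 * h%:R + 3 / 4.
Proof.
move=> h1; have hR : 1 <= h%:R :> R by rewrite ler1n.
have p8 := pi_sq_ge.
have p16 : pi ^+ 2 <= 16 :> R.
  by have := pi_ge2 R; have := pihalf_lt2 R => a b; nra.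
have V1 : (pi ^+ 2)^-1 <= 8^-1 :> R by rewrite lef_pV2 ?posrE //; lra.
have V2 : 16^-1 <= (pi ^+ 2)^-1 :> R by rewrite lef_pV2 ?posrE //; lra.
rewrite /Delta_; move: V1 V2; set v := (pi ^+ 2)^-1 => V1 V2.
by apply/andP; split; nra.
Qed.

(** The function [w exp w] is increasing on the positive numbers and, by the
    intermediate value theorem, takes the value [x], so [lambertW x] is the
    solution of its defining equation. *)
Lemma lambertW_ge (w x : R) : 0 < w -> w * expR w <= x -> w <= lambertW x.
Proof.
move=> w0 wx; have x0 : 0 < x by apply: lt_le_trans wx; rewrite mulr_gt0 ?expR_gt0.
have [c c0x cE] : exists2 c : R, c \in `[0, x] & c * expR c = x.
  apply: (@IVT R (fun w => w * expR w) 0 x x (ltW x0)).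
    apply: continuous_subspaceT => y; apply: cvgM; first exact: cvg_id.
    exact: continuous_expR.
  have xe : x <= x * expR x.
    by rewrite ler_peMr ?ltW // -expR0 ltr_expR.
  rewrite mul0r; apply/andP; split.
    by rewrite ge_min ltW.
  by rewrite le_max xe orbT.
have c0 : 0 < c.
  rewrite lt_neqAle; move: c0x; rewrite in_itv /= => /andP[-> _]; rewrite andbT.
  by apply/eqP => ce; move: cE x0; rewrite -ce mul0r => <-; rewrite ltxx.
have [l0 lE] : 0 < lambertW x /\ lambertW x * expR (lambertW x) = x.
  by apply: (@getPex _ [set w : R | 0 < w /\ w * expR w = x]%classic); exists c.
rewrite leNgt; apply/negP => lw; suff : x < x by rewrite ltxx.
apply: lt_le_trans wx; rewrite -[ltLHS]lE.
by apply: ltr_pM; rewrite ?ltW ?expR_gt0 // ltr_expR.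
Qed.

(** The argument of [lambertW] is at least [2^(3 h + 11)/(h + 1)].  Since
    [3 ln 2 > 3/2], this dominates [w exp w] for [w = 3 h/2 + 4]. *)
Lemma threshold_ge h : (3 <= h)%N ->
  expR ((h%:R + 1) * (3 / 2 * h%:R + 4)) <= threshold R h.
Proof.
move=> h3; have hR : 3 <= h%:R :> R by rewrite ler_nat.
rewrite /threshold ler_expR le_max; apply/orP; right.
have h0 : 0 < h%:R + 1 :> R by lra.
rewrite ler_pM2l //; apply: lambertW_ge; first by lra.
have /andP[D0 D1] := @Delta_bounds h ltac:(lia).
set X := h%:R * 2 ^+ (3 * h + 9) / Delta_ R h.
have XE : 2 ^+ (3 * h + 8) <= X.
  rewrite /X; have -> : 2 ^+ (3 * h + 9) = 2 * 2 ^+ (3 * h + 8) :> R.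
    by rewrite -exprS -addnS.
  have p : 0 < 2 ^+ (3 * h + 8) :> R by rewrite exprn_gt0.
  by rewrite ler_pdivlMr // mulrA [leRHS]mulrC ler_pM2l //; lra.
have X0 : 0 < X by apply: lt_le_trans XE; rewrite exprn_gt0.
have lX : (3 * h%:R + 8) * ln 2 <= ln X.
  have e : ln (2 ^+ (3 * h + 8)) = (3 * h%:R + 8) * ln 2 :> R.
    by rewrite lnXn // -[LHS]mulr_natl natrD natrM.
  by rewrite -e ler_ln ?posrE ?exprn_gt0.
rewrite [leRHS]mulrC ler_pdivlMr // /powR gt_eqF //.
have l2 := ln2_ge R.
(* the extra factor [X^(1/(h+1))] contributes at least [2^3] *)
have e1 : (3 * h%:R + 11) * (24 / 35) <= (h%:R + 2) / (h%:R + 1) * ln X.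
  rewrite mulrAC ler_pdivlMr //; apply: (@le_trans _ _
    ((h%:R + 2) * ((3 * h%:R + 8) * (24 / 35)))); first by nra.
  rewrite ler_pM2l; last by lra.
  by apply: le_trans lX; rewrite ler_pM2l; lra.
apply: (@le_trans _ _ (expR ((3 * h%:R + 11) * (24 / 35)))); last by rewrite ler_expR.
have [w wE] : exists w : R, w = 3 / 2 * h%:R + 4 by eexists.
rewrite -wE; pose d : R := (3 * h%:R + 11) * (24 / 35) - w.
have -> : (3 * h%:R + 11) * (24 / 35) = w + d by rewrite /d; lra.
rewrite expRD mulrAC [leRHS]mulrC ler_pM2r ?expR_gt0 //.
(* the eighth power of [1 + d/8 <= exp (d/8)] is a sufficient bound for [exp d] *)
pose v : R := 1 + d / 8.
have v3 : 144 / 100 + 69 / 1000 * h%:R <= v by rewrite /v /d wE; lra.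
have v0 : 0 <= v by lra.
have -> : d = 8%:R * (d / 8) by lra.
rewrite expRM_natl; apply: (@le_trans _ _ (v ^+ 8)); last first.
  by apply: lerXn2r; rewrite ?nnegrE ?expR_ge0 ?expR_ge1Dx.
have v2 : 27 / 10 + 227 / 1000 * (h%:R - 3) <= v ^+ 2 by nra.
have v4 : 27 / 10 + 143 / 100 * h%:R <= v ^+ 2 ^+ 2.
  apply: (@le_trans _ _ ((27 / 10 + 227 / 1000 * (h%:R - 3)) ^+ 2)); last first.
    by apply: lerXn2r v2; rewrite nnegrE ?sqr_ge0; lra.
  by have := sqr_ge0 (h%:R - 5 : R); rewrite !expr2; lra.
have -> : v ^+ 8 = (v ^+ 2 ^+ 2) ^+ 2 by rewrite -!exprM.
by rewrite wE; move: v4; set u := v ^+ 2 ^+ 2 => v4; nra.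
Qed.

End Threshold.

(** * A computable threshold, and the theorem *)

Lemma eq_recursive n (f g : n.-tuple nat -> nat) :
  f =1 g -> recursive f -> recursive g.
Proof. by move=> /funext ->. Qed.

Lemma computable_comp (f g : nat -> nat) :
  computable f -> computable g -> computable (f \o g).
Proof.
move=> rf rg; apply: eq_recursive (recursive_comp rf (fun _ : 'I_1 => rg)) => t.
by rewrite /thead tnth_mktuple.
Qed.

Lemma computable_succ : computable succn.
Proof. exact: recursive_succ. Qed.

Lemma recursive_addn :
  recursive (fun t : 2.-tuple nat => thead t + tnth t ord_max)%N.
Proof.
have rk : recursive (fun t : 3.-tuple nat => (tnth t (inord 1)).+1).
  apply: eq_recursive (recursive_comp recursive_succ
    (fun _ : 'I_1 => recursive_proj (inord 1 : 'I_3))) => t.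
  by rewrite /thead tnth_mktuple.
apply: eq_recursive (recursive_prec (recursive_proj (ord0 : 'I_1)) rk) => t.
case/tupleP: t => x t; case/tupleP: t => y t; rewrite (tuple0 t) !theadE.
have -> : tnth [tuple x; y] ord_max = y by [].
set b := [tuple of behead _]; have bE : tnth b ord0 = y by [].
clearbody b; elim: x => [|x IH] /=; first by rewrite bE.
by rewrite (tnth_nth 0%N) inordK //= IH addSn.
Qed.

Lemma computable_expn2 : computable (expn 2).
Proof.
have rk : recursive (fun t : 2.-tuple nat => 2 * tnth t ord_max)%N.
  apply: eq_recursive (recursive_comp recursive_addn
    (fun _ : 'I_2 => recursive_proj (ord_max : 'I_2))) => t.
  by rewrite /thead !tnth_mktuple mul2n addnn.
have rg : recursive (fun _ : 0.-tuple nat => 1%N).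
  apply: eq_recursive (recursive_comp recursive_succ
    (fun _ : 'I_1 => recursive_zero 0)) => t.
  by rewrite /thead tnth_mktuple.
apply: eq_recursive (recursive_prec rg rk) => t.
case/tupleP: t => x t; rewrite (tuple0 t) theadE.
by elim: x => [|x IH] //=; rewrite (tnth_nth 0%N) /= IH expnS.
Qed.

(** A double exponential is obtained from addition by one primitive recursion
    and compositions; its logarithm dominates [(h + 1) (3 h/2 + 4)]. *)
Lemma computable_expn2_expn2 : computable (fun h => 2 ^ 2 ^ (h + 4))%N.
Proof.
have -> : (fun h => 2 ^ 2 ^ (h + 4))%N =
    expn 2 \o (expn 2 \o (succn \o (succn \o (succn \o succn)))).
  by apply/funext => h /=; rewrite !addnS addn0.
have S := computable_succ; have E := computable_expn2.
exact: computable_comp E (computable_comp E (computable_comp S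
  (computable_comp S (computable_comp S S)))).
Qed.

Lemma ln_expn2_expn2_ge (R : realType) h Q : (3 <= h)%N -> (2 ^ 2 ^ (h + 4) <= Q)%N ->
  (h%:R + 1) * (3 / 2 * h%:R + 4) <= ln Q%:R :> R.
Proof.
move=> h3 hQ.
have pQ : (0 < 2 ^ 2 ^ (h + 4))%N by rewrite expn_gt0.
have Q0 : (0 < Q)%N by apply: leq_trans hQ.
have l2 := ln2_ge R.
apply: (@le_trans _ _ (ln (2 ^ 2 ^ (h + 4))%N%:R)); last first.
  by rewrite ler_ln ?posrE ?ltr0n // ler_nat.
rewrite natrX lnXn // -[leRHS]mulr_natl.
suff : ((h + 1) * (3 * h + 8) <= 2 ^ (h + 4))%N.
  have e : ((h + 1) * (3 * h + 8))%N%:R = (h%:R + 1) * (3 * h%:R + 8) :> R.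
    by rewrite natrM (natrD _ h 1) (natrD _ (3 * h) 8) natrM.
  rewrite -(ler_nat R) e => hp.
  apply: (@le_trans _ _ ((2 ^ (h + 4))%N%:R * 2^-1)); first by lra.
  by rewrite ler_wpM2l //; lra.
elim: h h3 {hQ pQ} => // h IH; rewrite leq_eqVlt => /orP[/eqP <-//|h3].
by have := IH h3; rewrite [(h.+1 + 4)%N]addSn expnS; move: (2 ^ (h + 4))%N => P; nia.
Qed.

Theorem theorem1p2 (R : realType) :
  (exists Qh : nat -> nat, computable Qh /\
     forall h Q : nat, (1 <= h)%N -> (2 <= Q)%N -> (Qh h <= Q)%N ->
       C_ R h Q < 3 * h%:R) /\
  (forall Q : nat, (2 <= Q)%N -> C_ R 1 Q < 3 * 1%:R) /\
  (forall Q : nat, (19397 <= Q)%N -> C_ R 2 Q < 3 * 2%:R) /\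
  (forall h Q : nat, (3 <= h)%N -> (2 <= Q)%N -> threshold R h <= Q%:R ->
       C_ R h Q < 3 * h%:R).
Proof.
split; last first.
  split; first exact: C1_lt.
  split; first exact: C2_lt.
  move=> h Q h3 Q2 tQ; apply: C_lt_of_large_ln => //.
  have Q0 : 0 < Q%:R :> R by rewrite ltr0n; apply: leq_trans Q2.
  by rewrite -ler_expR lnK ?posrE //; apply: le_trans (threshold_ge R h3) tQ.
exists (fun h => 2 ^ 2 ^ (h + 4))%N; split; first exact: computable_expn2_expn2.
move=> h Q h1 Q2 hQ; have [h3|h3] := leqP 3 h.
  by apply: C_lt_of_large_ln => //; apply: ln_expn2_expn2_ge.
case: h h1 h3 hQ => [|[|[|//]]] // _ _ hQ; first exact: C1_lt.
apply: C2_lt; apply: leq_trans hQ.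
apply: (@leq_trans (2 ^ 15)); first by [].
by rewrite leq_exp2l.
Qed.
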